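(* Let $(R,\mathcal B)$ be a commutative fusion ring with standard basis $\mathcal B=\{x_0=1,\dots,x_m\}$, and let $d\in\mathbb C$. Let $\mathbb A$ be the ring of algebraic integers. Consider the following three properties: (a) $d\,c^{\nu}_{\rho,\psi}\in\mathbb A$ for all $\nu,\rho,\psi\in\mathrm{Irr}(R_{\mathbb C})$, where $c^\nu_{\rho,\psi}$ are the structure constants of $R$; (b) $\widetilde\omega_i(d\,\mathrm S^\rho)\in\mathbb A$ for all $i\in\{0,\dots,m\}$ and all $\rho\in\mathrm{Irr}(R_{\mathbb C})$; (c) $\dfrac{d\,\mathrm{FPdim}(R)}{\mathrm{FPdim}(x_i)}\in\mathbb A$ for all $i\in\{0,\dots,m\}$. Then (a) implies (b), and (b) implies (c).
   Context: A fusion ring $(R,\mathcal B)$ is a ring $R$, free as a $\mathbb Z$-module with finite basis $\mathcal B=\{x_0,\dots,x_m\}$, such that $x_0=1$; $x_ix_j=\sum_k N_{ij}^kx_k$ with $N_{ij}^k\in\mathbb Z_{\ge0}$; and there is an involutive ring anti-automorphism $^*$ (here $R$ is commutative, so a ring automorphism) preserving $\mathcal B$, with $x_i^*=x_{i^*}$ and $N_{ij}^0=\delta_{i,j^*}$. Put $d_i=\mathrm{FPdim}(x_i)$ (Frobenius-Perron dimension), $\mathrm{FPdim}(R)=\sum_i d_i^2$, $R_{\mathbb C}=R\otimes_{\mathbb Z}\mathbb C$ (a semisimple algebra), $\mathrm{Irr}(R_{\mathbb C})$ the set of its irreducible characters, $F^\rho$ the primitive central idempotent corresponding to $\rho$.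 $\widehat{R_{\mathbb C}}$ is the linear dual of $R_{\mathbb C}$ with basis $\{x_i^\circ\}$ dual to $\{x_i\}$. It is a commutative algebra under the product $\star$ determined by $[\mu\star\nu]\left(\frac{x_s}{d_s}\right)=\mu\left(\frac{x_s}{d_s}\right)\nu\left(\frac{x_s}{d_s}\right)$ for all $s$. The Fourier transform is the linear bijection $\mathcal F:R_{\mathbb C}\to\widehat{R_{\mathbb C}}$, $x_i\mapsto\mathrm{FPdim}(R)\,x_{i^*}^\circ$. The matrix class sums are $\mathrm S^\rho:=\mathcal F(F^\rho)$, and $\widetilde\omega_i:\widehat{R_{\mathbb C}}\to\mathbb C$ is $\widetilde\omega_i(\mu)=\mu(x_i)/d_i$. Since $R$ is commutative, $\{\mathrm S^\rho\}_{\rho\in\mathrm{Irr}(R_{\mathbb C})}$ is a linear basis of $\widehat{R_{\mathbb C}}$, and the structure constants $c^\nu_{\rho,\psi}\in\mathbb C$ are defined by $$\mathrm S^\rho\star\mathrm S^\psi=\sum_{\nu\in\mathrm{Irr}(R_{\mathbb C})}c^\nu_{\rho,\psi}\,\mathrm S^\nu.$$ *)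

(* Defs.v *)
From HB Require Import structures.
From mathcomp Require Import all_boot all_order all_algebra.
From mathcomp Require Import classical_sets boolp fsbigop reals complex.

Set Implicit Arguments.
Unset Strict Implicit.
Unset Printing Implicit Defensive.

Import Order.TTheory GRing.Theory Num.Theory.
Local Open Scope classical_set_scope.
Local Open Scope ring_scope.
Local Open Scope complex_scope.

Record fusion_ring (R : nzRingType) (m : nat) := FusionRing {
  basis : 'I_m.+1 -> R;
  fcoef : 'I_m.+1 -> 'I_m.+1 -> 'I_m.+1 -> nat;
  star : {additive R -> R};
  dual : 'I_m.+1 -> 'I_m.+1;
  basis_free : forall c : 'I_m.+1 -> int,
    \sum_i basis i *~ c i = 0 -> forall i, c i = 0;
  basis_span : forall r : R,
    exists c : 'I_m.+1 -> int, r = \sum_i basis i *~ c i;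
  basis0 : basis ord0 = 1;
  basisM : forall i j, basis i * basis j = \sum_k basis k *+ fcoef i j k;
  starM : forall a b, star (a * b) = star b * star a;
  starK : involutive star;
  star_basis : forall i, star (basis i) = basis (dual i);
  fcoef0 : forall i j, fcoef i j ord0 = (i == dual j)
}.

Section FusionCoef.
Variables (R : nzRingType) (m : nat) (B : fusion_ring R m).
Implicit Types i j k l : 'I_m.+1.

Lemma basis_inj_coef (a b : 'I_m.+1 -> nat) :
  \sum_k basis B k *+ a k = \sum_k basis B k *+ b k -> a =1 b.
Proof.
move=> eab k; apply/eqP; rewrite -eqz_nat -subr_eq0; apply/eqP.
apply: (basis_free (f := B) (c := fun k => (a k)%:Z - (b k)%:Z)).
under eq_bigr do rewrite mulrzBr -!pmulrn.
by rewrite sumrB eab subrr.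
Qed.

Lemma fcoef_1l j k : fcoef B ord0 j k = (k == j).
Proof.
move: k; apply: basis_inj_coef; rewrite -basisM basis0 mul1r.
rewrite (bigD1 j) //= eqxx big1 ?addr0 // => k /negPf-> //.
Qed.

Lemma fcoef_1r i k : fcoef B i ord0 k = (k == i).
Proof.
move: k; apply: basis_inj_coef; rewrite -basisM basis0 mulr1.
rewrite (bigD1 i) //= eqxx big1 ?addr0 // => k /negPf-> //.
Qed.

Lemma fcoefA i j k s :
  (\sum_l fcoef B j k l * fcoef B i l s =
   \sum_l fcoef B i j l * fcoef B l k s)%N.
Proof.
move: s; apply: basis_inj_coef.
transitivity (basis B i * (basis B j * basis B k)).
  rewrite basisM mulr_sumr; under [RHS]eq_bigr do
    rewrite mulrnAr basisM -sumrMnl.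
  rewrite exchange_big; apply: eq_bigr => s _ /=.
  by rewrite -sumrMnr; apply: eq_bigr => l _; rewrite mulnC mulrnA.
rewrite mulrA basisM mulr_suml; under eq_bigr do
  rewrite mulrnAl basisM -sumrMnl.
rewrite exchange_big; apply: eq_bigr => s _ /=.
by rewrite -sumrMnr; apply: eq_bigr => l _; rewrite mulnC mulrnA.
Qed.

End FusionCoef.

(* The algebra R_C = R (x)_Z C: an element is the row of its coordinates in   *)
(* the basis x_0, ..., x_m; the product extends that of R bilinearly.         *)
Definition fusionC (K : realType) (R : nzRingType) m (B : fusion_ring R m)
  : Type := 'rV[K[i]]_m.+1.

Section FusionAlgebra.
Variables (K : realType) (R : nzRingType) (m : nat) (B : fusion_ring R m).
Local Notation C := (K[i]).
Local Notation RC := (fusionC K B).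

HB.instance Definition _ := Vector.copy RC 'rV[C]_m.+1.

Definition basisC (i : 'I_m.+1) : RC := delta_mx 0 i.

Definition fusionC_mul (f g : RC) : RC :=
  \row_k \sum_i \sum_j f 0 i * g 0 j * (fcoef B i j k)%:R.

Fact fusionC_mulA : associative fusionC_mul.
Proof.
move=> f g h; apply/rowP=> s; rewrite !mxE.
transitivity (\sum_i \sum_j \sum_k f 0 i * g 0 j * h 0 k *
               (\sum_l fcoef B j k l * fcoef B i l s)%:R).
  apply: eq_bigr => i _.
  under eq_bigr => l _ do rewrite mxE mulr_sumr mulr_suml.
  rewrite exchange_big; apply: eq_bigr => j _ /=.
  under eq_bigr => l _ do rewrite mulr_sumr mulr_suml.
  rewrite exchange_big; apply: eq_bigr => k _ /=.
  rewrite natr_sum mulr_sumr; apply: eq_bigr => l _.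
  by rewrite natrM !mulrA.
transitivity (\sum_i \sum_j \sum_k f 0 i * g 0 j * h 0 k *
               (\sum_l fcoef B i j l * fcoef B l k s)%:R).
  by do 3!apply: eq_bigr => ? _; rewrite fcoefA.
symmetry; under eq_bigr => l _.
  under eq_bigr => k _ do rewrite mxE !mulr_suml.
  rewrite exchange_big /=.
  under eq_bigr => i _.
    under eq_bigr => k _ do rewrite !mulr_suml.
    over.
  over.
rewrite exchange_big; apply: eq_bigr => i _ /=.
under eq_bigr => l _ do rewrite exchange_big /=.
rewrite exchange_big; apply: eq_bigr => j _ /=.
rewrite exchange_big; apply: eq_bigr => k _ /=.
rewrite natr_sum mulr_sumr; apply: eq_bigr => l _.
by rewrite natrM !mulrA; congr (_ * _); rewrite mulrAC.
Qed.

Fact fusionC_mul1l : left_id (basisC ord0) fusionC_mul.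
Proof.
move=> f; apply/rowP=> k; rewrite mxE (bigD1 ord0) //= [X in _ + X]big1.
  rewrite addr0 (bigD1 k) //= big1 => [|j njk].
    by rewrite fcoef_1l mxE !eqxx mul1r mulr1 addr0.
  by rewrite fcoef_1l eq_sym (negPf njk) mulr0.
by move=> i ni; rewrite big1 // => j _; rewrite mxE (negPf ni) andbF !mul0r.
Qed.

Fact fusionC_mul1r : right_id (basisC ord0) fusionC_mul.
Proof.
move=> f; apply/rowP=> k; rewrite mxE exchange_big (bigD1 ord0) //=.
rewrite [X in _ + X]big1.
  rewrite addr0 (bigD1 k) //= big1 => [|j njk].
    by rewrite fcoef_1r mxE !eqxx !mulr1 addr0.
  by rewrite fcoef_1r eq_sym (negPf njk) mulr0.
move=> i ni; rewrite big1 // => j _.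
by rewrite mxE (negPf ni) andbF mulr0 mul0r.
Qed.

Fact fusionC_mulDl : left_distributive fusionC_mul +%R.
Proof.
move=> f g h; apply/rowP=> k; rewrite !mxE -big_split; apply: eq_bigr => i _.
rewrite -big_split; apply: eq_bigr => j _ /=; by rewrite mxE !mulrDl.
Qed.

Fact fusionC_mulDr : right_distributive fusionC_mul +%R.
Proof.
move=> f g h; apply/rowP=> k; rewrite !mxE -big_split; apply: eq_bigr => i _.
rewrite -big_split; apply: eq_bigr => j _ /=; by rewrite mxE mulrDr mulrDl.
Qed.

Fact fusionC_1_neq0 : basisC ord0 != 0.
Proof.
by apply/eqP=> /rowP/(_ ord0)/eqP; rewrite !mxE !eqxx oner_eq0.
Qed.

HB.instance Definition _ := GRing.Zmodule_isNzRing.Build RC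
  fusionC_mulA fusionC_mul1l fusionC_mul1r fusionC_mulDl fusionC_mulDr
  fusionC_1_neq0.

Fact fusionC_scalerAl (a : C) (f g : RC) : a *: (f * g) = (a *: f) * g.
Proof.
apply/rowP=> k; rewrite !mxE mulr_sumr; apply: eq_bigr => i _.
by rewrite mulr_sumr; apply: eq_bigr => j _; rewrite mxE !mulrA.
Qed.

HB.instance Definition _ := GRing.Lmodule_isLalgebra.Build C RC
  fusionC_scalerAl.

Fact fusionC_scalerAr (a : C) (f g : RC) : a *: (f * g) = f * (a *: g).
Proof.
apply/rowP=> k; rewrite !mxE mulr_sumr; apply: eq_bigr => i _.
rewrite mulr_sumr; apply: eq_bigr => j _; rewrite mxE !mulrA.
by congr (_ * _ * _); rewrite mulrC.
Qed.

HB.instance Definition _ := GRing.Lalgebra_isAlgebra.Build C RC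
  fusionC_scalerAr.

Lemma basisC0 : basisC ord0 = 1. Proof. by []. Qed.

Lemma basisCM (i j : 'I_m.+1) :
  basisC i * basisC j = \sum_k basisC k *+ fcoef B i j k.
Proof.
apply/rowP=> k; rewrite [RHS]summxE mxE (bigD1 i) //= [X in _ + X]big1.
  rewrite addr0 (bigD1 j) //= big1 => [|j' nj]; last first.
    by rewrite !mxE (negPf nj) andbF mulr0 mul0r.
  rewrite (bigD1 k) //= big1 => [|l nl].
    by rewrite mulmxnE !mxE !eqxx mul1r mul1r.
  by rewrite mulmxnE mxE eq_sym (negPf nl) andbF mul0rn.
move=> i' ni; rewrite big1 // => j' _.
by rewrite mxE (negPf ni) andbF !mul0r.
Qed.

End FusionAlgebra.

Section FusionData.
Variables (K : realType) (R : nzRingType) (m : nat) (B : fusion_ring R m).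
Local Notation C := (K[i]).
Local Notation RC := (fusionC K B).

Definition mulmat (i : 'I_m.+1) : 'M[K]_m.+1 :=
  \matrix_(j, k) (fcoef B i j k)%:R.

(* The largest nonnegative real eigenvalue of left multiplication by x_i: the *)
(* set is finite, and nonempty by the Perron-Frobenius theorem. *)
Definition FPdim (i : 'I_m.+1) : K :=
  sup [set a : K | 0 <= a /\ eigenvalue (mulmat i) a].

Definition FPdimR : K := \sum_i FPdim i ^+ 2.

Definition irreducible_repr n (rho : {lrmorphism RC -> 'M[C]_n.+1}) : Prop :=
  forall U : 'M[C]_n.+1, (forall a : RC, stablemx U (rho a)) ->
  U = 0 \/ row_full U.

Definition dualC := 'Hom(RC, C^o).

Definition Irr : set dualC :=
  [set chi : dualC | exists n (rho : {lrmorphism RC -> 'M[C]_n.+1}),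
     irreducible_repr rho /\ forall a : RC, chi a = \tr (rho a)].

Definition central_idempotent (e : RC) : Prop :=
  e * e = e /\ forall a : RC, a * e = e * a.

Definition primitive_central_idempotent (e : RC) : Prop :=
  [/\ central_idempotent e, e != 0 &
      forall f g : RC, central_idempotent f -> central_idempotent g ->
        f * g = 0 -> e = f + g -> f = 0 \/ g = 0].

(* F^rho: the primitive central idempotent on which rho does not vanish;      *)
(* it is unique for rho in Irr because R_C is semisimple.                     *)
Definition pci (rho : dualC) : RC :=
  xget 0 [set e | primitive_central_idempotent e /\ rho e != 0].

Definition dual_basis (i : 'I_m.+1) : dualC :=
  linfun (fun f : RC => f 0 i : C^o).

Definition fourier (f : RC) : dualC :=
  \sum_i (f 0 i * (FPdimR)%:C) *: dual_basis (dual B i).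

Definition normalized_basis (s : 'I_m.+1) : RC :=
  ((FPdim s)%:C)^-1 *: basisC K B s.

(* Since mu star nu is prescribed on x_s / d_s, its value on x_s carries the  *)
(* factor d_s below; see star_prodE.                                          *)
Definition star_prod (mu nu : dualC) : dualC :=
  \sum_s ((FPdim s)%:C * (mu (normalized_basis s) * nu (normalized_basis s)))
    *: dual_basis s.

Definition class_sum (rho : dualC) : dualC := fourier (pci rho).

Definition omega (i : 'I_m.+1) (mu : dualC) : C :=
  mu (basisC K B i) / (FPdim i)%:C.

(* c^nu_{rho,psi}: the coordinate on S^nu of S^rho star S^psi.  The sum runs  *)
(* over the finite set Irr; xget picks the unique family of coordinates       *)
(* (extended by 0 outside Irr).                                               *)
Definition struct_const (nu rho psi : dualC) : C :=
  xget (fun=> 0)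
    [set c : dualC -> C | (forall chi, ~ Irr chi -> c chi = 0) /\
       star_prod (class_sum rho) (class_sum psi) =
         \sum_(chi \in Irr) c chi *: class_sum chi] nu.

Lemma dual_basisE i (f : RC) : dual_basis i f = f 0 i.
Proof.
pose h := fun f : RC => f 0 i : C^o.
have lin_h : linear h by move=> a u v; rewrite /h !mxE.
pose hL := HB.pack_for {linear RC -> C^o} h
  (GRing.isLinear.Build _ _ _ _ h lin_h).
exact: (lfunE hL f).
Qed.

Lemma dual_basis_basisC i j : dual_basis i (basisC K B j) = (i == j)%:R.
Proof. by rewrite dual_basisE mxE. Qed.

Lemma star_prodE (mu nu : dualC) s : FPdim s != 0 ->
  star_prod mu nu (normalized_basis s) =
    mu (normalized_basis s) * nu (normalized_basis s).
Proof.
move=> ds0; rewrite sum_lfunE (bigD1 s) //= big1 => [|t nts].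
  rewrite addr0 scale_lfunE dual_basisE mxE mxE !eqxx mulr1.
  have dC0 : (FPdim s)%:C != 0 by rewrite fmorph_eq0.
  by rewrite /GRing.scale /= mulrC mulrA mulVf // mul1r.
by rewrite scale_lfunE dual_basisE mxE mxE eqxx (negPf nts) mulr0 scaler0.
Qed.

Lemma fourier_basisC i :
  fourier (basisC K B i) = (FPdimR)%:C *: dual_basis (dual B i).
Proof.
rewrite /fourier (bigD1 i) //= big1 => [|j nji].
  by rewrite mxE !eqxx mul1r addr0.
by rewrite mxE (negPf nji) andbF mul0r scale0r.
Qed.

End FusionData.

Definition algebraic_integer (K : realType) (z : K[i]) : Prop :=
  integralOver (intr : int -> K[i]) z.

(* Main.v *)
(* In the basis B, multiplication by x_j is a matrix whose transpose is       *)
(* multiplication by x_{j*}; these matrices commute, so they are normal and   *)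
(* hence simultaneously diagonalizable.  This yields the characters chi_r and *)
(* idempotents E_r with x = \sum_r chi_r(x) E_r, Irr = {chi_r} and            *)
(* F^(chi_r) = E_r, so that                                                   *)
(*      omega_i(S^r) = FPdim(R) (E_r)_{i*} / d_i.                             *)
(* (a) => (b): omega_i is multiplicative for star, so d omega_i(S^r) is an    *)
(* eigenvalue of the matrix (d c^t_{r,s})_{t,s}, with eigenvector             *)
(* (omega_i(S^t))_t.                                                          *)
(* (b) => (c): comparing coefficients of x_{i*} in x_{i*} = \sum_r            *)
(* chi_r(x_{i*}) E_r gives                                                    *)
(*      d FPdim(R) / d_i = \sum_r chi_r(x_{i*}) omega_i(d S^r),               *)
(* and chi_r(x_{i*}) is an eigenvalue of an integer matrix.                   *)

Require Import Defs.
From HB Require Import structures.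
From mathcomp Require Import all_boot all_order all_algebra.
From mathcomp Require Import classical_sets boolp fsbigop reals complex ring.

Set Implicit Arguments.
Unset Strict Implicit.
Unset Printing Implicit Defensive.

Import GRing.Theory.
Local Open Scope ring_scope.
Local Open Scope complex_scope.

(** Diagonalizing the multiplication matrices identifies R_C with a product of m+1 copies of C. The
    coordinate projections chi_r are exactly the elements of [Irr] ([Irr_char_sys],
    [Irr_char_sysP]), and the standard idempotents E_r are their [pci] ([pci_char_sys]). Both
    implications then reduce to the explicit value [omega_class_sum], the expansion [char_sys_sum]
    of basis elements over the E_r, and the integrality of eigenvalues of matrices with integral
    entries ([integral_eigenvalue]). *)

Section Integrality.
Variables (S : comNzRingType) (F : fieldType) (f : {rmorphism S -> F}).

(** * Integrality of eigenvalues *)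

Lemma integral_char_poly n (A : 'M[F]_n) :
    (forall i j, integralOver f (A i j)) ->
  forall k, integralOver f (char_poly A)`_k.
Proof.
move=> intA; pose P (p : {poly F}) := forall k, integralOver f p`_k.
have P0 : P 0 by move=> k; rewrite coef0; apply: integral0.
have P1 : P 1 by move=> k; rewrite coef1; apply: integral_nat.
have PD p q : P p -> P q -> P (p + q).
  by move=> Pp Pq k; rewrite coefD; apply: integral_add.
have PN p : P p -> P (- p).
  by move=> Pp k; rewrite coefN; apply: integral_opp.
have PM p q : P p -> P q -> P (p * q).
  move=> Pp Pq k; rewrite coefM.
  apply: big_ind => [||i _]; first exact: integral0.
    exact: integral_add.
  exact: integral_mul.
(* The determinant is unfolded as its Leibniz sum over permutations. *)
apply: (big_ind P) => // s _; apply: (PM).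
  by rewrite -signr_odd; case: odd; rewrite ?expr1 ?expr0 //; apply: PN.
apply: (big_ind P) => // i _; rewrite !mxE; apply: PD.
  by case: eqP => _ k; rewrite ?coef0 ?coefX;
    [apply: integral_nat|apply: integral0].
by apply: PN => k; rewrite coefC; case: eqP => _;
  [apply: intA|apply: integral0].
Qed.

Lemma integral_eigenvalue n (A : 'M[F]_n) a :
  (forall i j, integralOver f (A i j)) -> eigenvalue A a -> integralOver f a.
Proof.
move=> intA; rewrite eigenvalue_root_char => /integral_root_monic; apply.
  exact: char_poly_monic.
by apply/integral_poly; apply: integral_char_poly.
Qed.

End Integrality.

(** * Symmetries of the fusion coefficients *)

Section FusionCombinatorics.
Variables (R : comNzRingType) (m : nat) (B : fusion_ring R m).

Lemma basis_inj : injective (basis B).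
Proof.
move=> i j eij; apply/eqP; apply: contraT => nij.
pose c k : int := (k == i)%:Z - (k == j)%:Z.
suff /Defs.basis_free/(_ i) : \sum_k basis B k *~ c k = 0.
  by rewrite /c eqxx (negPf nij).
under eq_bigr do rewrite mulrzBr.
have sum1 l : \sum_k basis B k *~ (k == l)%:Z = basis B l.
  by rewrite (bigD1 l) //= eqxx big1 ?addr0 // => k /negPf->.
by rewrite sumrB !sum1 eij subrr.
Qed.

Lemma dualK : involutive (dual B).
Proof. by move=> i; apply: basis_inj; rewrite -!star_basis starK. Qed.

Lemma fcoefC i j k : fcoef B i j k = fcoef B j i k.
Proof. by move: k; apply: (@basis_inj_coef _ _ B); rewrite -!basisM mulrC. Qed.

Lemma fcoef_dual_dual i j k :
  fcoef B (dual B i) (dual B j) k = fcoef B i j (dual B k).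
Proof.
move: k; apply: (@basis_inj_coef _ _ B).
rewrite -basisM -!star_basis mulrC -starM basisM raddf_sum /=.
rewrite (reindex_inj (inv_inj dualK)) /=; apply: eq_bigr => k _.
by rewrite raddfMn star_basis dualK.
Qed.

(* Both sides are the coefficient of 1 in x_i x_j x_k. *)
Lemma fcoef_rot i j k : fcoef B j k (dual B i) = fcoef B i j (dual B k).
Proof.
have sum1 (a : 'I_m.+1 -> nat) l0 : (\sum_l a l * (l == l0) = a l0)%N.
  rewrite (bigD1 l0) //= eqxx muln1 big1 ?addn0 // => l /negPf->.
  by rewrite muln0.
have := fcoefA B i j k ord0.
under eq_bigr do rewrite fcoef0 eq_sym (inv_eq dualK).
by under [RHS]eq_bigr do rewrite fcoef0; rewrite !sum1.
Qed.

(** Multiplication by x_{j*} is thus the transpose of multiplication by x_j, which makes [rmulmat j]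
    normal. *)
Lemma fcoef_dual i j k : fcoef B i (dual B j) k = fcoef B k j i.
Proof.
by rewrite -[i in LHS]dualK fcoef_dual_dual -fcoef_rot dualK fcoefC.
Qed.

End FusionCombinatorics.

(** * Simultaneous diagonalization of R_C *)

Section Characters.
Variables (K : realType) (R : comNzRingType) (m : nat) (B : fusion_ring R m).
Local Notation C := (K[i]).
Local Notation RC := (fusionC K B).
Local Notation dRC := (dualC K B).

Lemma fusionC_mulC (a b : RC) : a * b = b * a.
Proof.
apply/rowP=> k; rewrite !mxE exchange_big; apply: eq_bigr => i _.
by apply: eq_bigr => j _; rewrite fcoefC [a 0 j * _]mulrC.
Qed.

Definition rmulmat (j : 'I_m.+1) : 'M[C]_m.+1 :=
  \matrix_(i, k) (fcoef B i j k)%:R.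

Lemma mul_rmulmat (a : RC) j : (a *m rmulmat j : RC) = a * basisC K B j.
Proof.
apply/rowP=> k; rewrite !mxE; apply: eq_bigr => i _.
rewrite (bigD1 j) //= big1 => [|l nl]; first by rewrite !mxE !eqxx mulr1 addr0.
by rewrite !mxE (negPf nl) andbF mulr0 mul0r.
Qed.

Lemma basisC_decomp (a : RC) : a = \sum_j a 0 j *: basisC K B j.
Proof. exact: row_sum_delta. Qed.

Lemma rmulmat_comm i j : comm_mx (rmulmat i) (rmulmat j).
Proof.
apply/row_matrixP=> k; rewrite !rowE !mulmxA.
have rowL (a : RC) l : a *m rmulmat l = (a * basisC K B l : RC)
  by rewrite mul_rmulmat.
by rewrite !rowL -!mulrA [basisC K B i * _]fusionC_mulC.
Qed.

Lemma rmulmat_diagonalizable j :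
  exists2 P, P \in unitmx & similar_diag P (rmulmat j).
Proof.
have normL : rmulmat j \is normalmx.
  apply/normalmxP; suff -> : ((rmulmat j)^t*)%sesqui = rmulmat (dual B j).
    exact: rmulmat_comm.
  by apply/matrixP=> i k; rewrite !mxE rmorph_nat fcoef_dual.
exists (spectralmx (rmulmat j)); first exact/unitarymx_unit/spectral_unitarymx.
apply/similar_diagPex; exists (spectral_diag (rmulmat j)).
apply/similarP; first exact/unitarymx_unit/spectral_unitarymx.
rewrite {2}(orthomx_spectralP normL) !mulmxA mulmxV ?mul1mx //.
exact/unitarymx_unit/spectral_unitarymx.
Qed.

Lemma rmulmat_codiagonalizable : exists2 P : 'M[C]_m.+1, P \in unitmx &
  forall j, exists D, P *m rmulmat j = diag_mx D *m P.
Proof.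
have [|P Pu /allP PD] := (codiagonalizableP (codom rmulmat)).1.
  split=> [_ _ /codomP[i ->] /codomP[j ->]|_ /codomP[j ->]].
    exact: rmulmat_comm.
  exact: rmulmat_diagonalizable.
exists P => // j.
have /similar_diagPex[D /(similarP Pu) PjD] := PD _ (codom_f rmulmat j).
by exists D.
Qed.

(** An algebra isomorphism of R_C with C^(m+1): [chi] gives the coordinate projections and [E] the
    standard idempotents. *)
Definition character_system (chi : 'I_m.+1 -> dRC) (E : 'I_m.+1 -> RC) :=
  [/\ forall r, chi r 1 = 1,
      forall r a b, chi r (a * b) = chi r a * chi r b,
      forall a, a = \sum_r chi r a *: E r &
      forall r s, chi r (E s) = (r == s)%:R].

(** The rows e_r of P are common eigenvectors forming a basis; chi_r(a) is the eigenvalue of a on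
    e_r, and E_r is the component of 1 along e_r. *)
Lemma character_system_exists : exists chi E, character_system chi E.
Proof.
have [P Pu PD] := rmulmat_codiagonalizable.
have [D {}PD] := fin_all_exists PD.
pose e r : RC := row r P.
have e_free (c : 'I_m.+1 -> C) : \sum_r c r *: e r = 0 -> forall r, c r = 0.
  move=> c0 r; pose v := \row_r c r.
  suff: v = 0 by move/rowP/(_ r); rewrite !mxE.
  have vP0 : v *m P = 0.
    by rewrite mulmx_sum_row -[RHS]c0; apply: eq_bigr => s _; rewrite mxE.
  by rewrite -[v](mulmxK Pu) vP0 mul0mx.
have e_basis r j : e r * basisC K B j = D j 0 r *: e r.
  rewrite -mul_rmulmat /e -row_mul PD.
  by apply/rowP=> k; rewrite mul_diag_mx !mxE.
pose lam r (a : RC) : C^o := \sum_j a 0 j * D j 0 r.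
have lam_lin r : linear (lam r).
  move=> c a b; rewrite /lam /GRing.scale /= mulr_sumr -big_split.
  by apply: eq_bigr => j _; rewrite !mxE mulrDl mulrA.
pose chi r : dRC := linfun (HB.pack_for {linear RC -> C^o} (lam r)
  (GRing.isLinear.Build _ _ _ _ (lam r) (lam_lin r))).
have chiE r a : e r * a = chi r a *: e r.
  rewrite lfunE /= {1}(basisC_decomp a) mulr_sumr scaler_suml.
  by apply: eq_bigr => j _; rewrite -scalerAr e_basis scalerA.
have sum_delta s : \sum_r (r == s)%:R *: e r = e s.
  rewrite (bigD1 s) //= eqxx scale1r big1 ?addr0 // => r /negPf->.
  by rewrite scale0r.
have e_inj (a b : 'I_m.+1 -> C) :
    \sum_r a r *: e r = \sum_r b r *: e r -> a =1 b.
  move=> eab r; apply/eqP; rewrite -subr_eq0; apply/eqP.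
  apply: (e_free (fun r => a r - b r)); under eq_bigr do rewrite scalerBl.
  by rewrite sumrB eab subrr.
have e_neq0 r : e r != 0.
  apply/eqP=> er0; have /(_ _ r)/eqP := e_free (fun s => (s == r)%:R).
  by rewrite sum_delta eqxx oner_eq0 => /(_ er0).
have scale_inj r : injective (fun c : C => c *: e r).
  move=> a b /eqP; rewrite -subr_eq0 -scalerBl scaler_eq0.
  by rewrite (negPf (e_neq0 r)) orbF subr_eq0 => /eqP.
pose c r : C := ((1 : RC) *m invmx P) 0 r.
have one_dec : 1 = \sum_r c r *: e r.
  by rewrite -[LHS](mulmxKV Pu) mulmx_sum_row.
pose E r := c r *: e r.
have dec a : a = \sum_r chi r a *: E r.
  rewrite -[LHS]mul1r one_dec mulr_suml; apply: eq_bigr => r _.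
  by rewrite -scalerAl chiE !scalerA mulrC.
have chi_e r s : chi r (e s) * c r = (r == s)%:R.
  move: r; apply: e_inj; rewrite sum_delta [RHS]dec.
  by apply: eq_bigr => r _; rewrite scalerA.
exists chi, E; split=> // [r|r a b|r s].
- by apply: (scale_inj r); rewrite -chiE mulr1 scale1r.
- apply: (scale_inj r); rewrite -chiE mulrA !chiE -scalerAl chiE scalerA.
  by [].
- rewrite /E linearZ /= [LHS]mulrC; have [<-|nrs] := eqVneq r s.
    by rewrite chi_e eqxx.
  (* [chi_e] carries the factor [c r], not [c s]; it cannot vanish, as [chi_e r r] would then read 0
     = 1. *)
  have /eqP := chi_e r s; rewrite (negPf nrs) mulf_eq0 => /orP[/eqP->|/eqP cr0].
    by rewrite mul0r.
  by have /eqP := chi_e r r; rewrite cr0 mulr0 eqxx eq_sym oner_eq0.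
Qed.

(** * Primitive idempotents and irreducible characters *)

Section CharacterSystem.
Variables (chi : 'I_m.+1 -> dRC) (E : 'I_m.+1 -> RC).
Hypothesis chiE : character_system chi E.

Lemma char_sys_eq (a b : RC) : (forall r, chi r a = chi r b) -> a = b.
Proof.
have [_ _ dec _] := chiE; move=> ab; rewrite (dec a) (dec b).
by apply: eq_bigr => r _; rewrite ab.
Qed.

Lemma char_sys_mulr (a : RC) s : a * E s = chi s a *: E s.
Proof.
have [_ chiM _ chiEE] := chiE; apply: char_sys_eq => r.
rewrite chiM linearZ /= chiEE; have [->|_] := eqVneq r s; first by [].
by rewrite mulr0 scaler0.
Qed.

Lemma char_sys_idem s : E s * E s = E s.
Proof. by have [_ _ _ EE] := chiE; rewrite char_sys_mulr EE eqxx scale1r. Qed.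

Lemma char_sys_neq0 s : E s != 0.
Proof.
have [_ _ _ chiEE] := chiE; apply/eqP=> E0.
by have /eqP := chiEE s s; rewrite E0 linear0 eqxx eq_sym oner_eq0.
Qed.

Lemma char_sys_inj : injective chi.
Proof.
have [_ _ _ chiEE] := chiE; move=> r s ers; apply/eqP.
have /eqP := chiEE r s; rewrite ers chiEE eqxx.
by case: (r == s) => //; rewrite oner_eq0.
Qed.

(** The ideal generated by E_s is a line, so an idempotent summand of E_s is a E_s with a a = a. *)
Lemma char_sys_primitive s : primitive_central_idempotent (E s).
Proof.
have [_ chiM _ chiEE] := chiE; split; [split|exact: char_sys_neq0|].
- exact: char_sys_idem.
- by move=> a; rewrite fusionC_mulC.
move=> f g [ff _] _ fg Es; pose a := chi s f.
have fE : f = a *: E s by rewrite -char_sys_mulr Es mulrDr ff fg addr0.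
have : a * a == a by rewrite /a -chiM ff.
rewrite -subr_eq0 -{3}[a]mulr1 -mulrBr mulf_eq0 subr_eq0.
case/orP=> /eqP a1; [left|right]; first by rewrite fE a1 scale0r.
by apply: (addrI f); rewrite -Es addr0 fE a1 scale1r.
Qed.

(** Here chi_s(e) = 1, so e splits into the orthogonal idempotents E_s and e - E_s, and primitivity
    kills the second. *)
Lemma char_sys_primitive_uniq s (e : RC) :
  primitive_central_idempotent e -> chi s e != 0 -> e = E s.
Proof.
have [_ chiM _ _] := chiE; case=> [[ee _] e0 eprim] se0.
have se1 : chi s e = 1 by apply: (mulfI se0); rewrite -chiM ee mulr1.
have eE : e * E s = E s by rewrite char_sys_mulr se1 scale1r.
have Ee : E s * e = E s by rewrite fusionC_mulC.
have central (f : RC) : f * f = f -> central_idempotent f.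
  by move=> ff; split=> // a; rewrite fusionC_mulC.
have [||||/eqP|/eqP] := eprim (E s) (e - E s).
- exact/central/char_sys_idem.
- by apply: central; rewrite mulrBl !mulrBr ee eE Ee char_sys_idem subrr subr0.
- by rewrite mulrBr Ee char_sys_idem subrr.
- by rewrite addrC subrK.
- by rewrite (negPf (char_sys_neq0 s)).
- by rewrite subr_eq0 => /eqP.
Qed.

Lemma pci_char_sys s : pci (chi s) = E s.
Proof.
have [_ _ _ chiEE] := chiE.
rewrite /pci; case: xgetP => [e _ [pe se]|/(_ (E s)) []].
  exact: char_sys_primitive_uniq.
by split; [exact: char_sys_primitive|rewrite chiEE eqxx oner_eq0].
Qed.

Lemma Irr_char_sys s : Irr (chi s).
Proof.
have [chi1 chiM _ _] := chiE.
pose h (a : RC) : 'M[C]_1 := (chi s a)%:M.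
have h_lin : linear h.
  by move=> c a b; rewrite /h linearP /= raddfD /= -scale_scalar_mx.
have h_mul : monoid_morphism h.
  by split=> [|a b]; rewrite /h ?chi1 // chiM scalar_mxM.
pose rho := HB.pack_for {lrmorphism RC -> 'M[C]_1} h
  (GRing.isLinear.Build _ _ _ _ h h_lin)
  (GRing.isMonoidMorphism.Build _ _ h h_mul).
(* Index [n] stands for dimension [n.+1], so 0 means dimension one. *)
exists 0, rho; split=> [U _|a]; last by rewrite /= mxtrace_scalar.
have [->|U0] := eqVneq U 0; [by left|right].
by rewrite /row_full eqn_leq rank_leq_col lt0n mxrank_eq0.
Qed.

(** Some E_s acts by a nonzero idempotent whose image is stable, hence full, so E_s acts as 1 and
    every a as the scalar chi_s(a). All lines are then stable, which forces dimension one. *)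
Lemma Irr_char_sysP (mu : dRC) : Irr mu -> exists s, mu = chi s.
Proof.
have [chi1 chiM dec _] := chiE; case=> n [rho [irr mu_rho]].
have [s Es0] : exists s, rho (E s) != 0.
  apply: contrapT => /forallNP rho0.
  have /eqP : rho 1 = 0.
    rewrite (dec 1) linear_sum big1 // => s _; rewrite linearZ /=.
    by have /negP := rho0 s; rewrite negbK => /eqP->; rewrite scaler0.
  by rewrite rmorph1 oner_eq0.
have rhoM a b : rho (a * b) = rho a *m rho b by rewrite [LHS]rmorphM.
have rhoC a b : rho a *m rho b = rho b *m rho a by rewrite -!rhoM fusionC_mulC.
have fullE : row_full (rho (E s)).
  by have [a|/eqP|//] := irr (rho (E s)); rewrite ?(negPf Es0) // rhoC submxMl.
have rhoE1 : rho (E s) = 1%:M.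
  have uE : rho (E s) \in unitmx by rewrite -row_full_unit.
  apply: (can_inj (mulKmx uE)); rewrite mulmx1.
  by rewrite -rhoM char_sys_idem.
have rho_scalar a : rho a = (chi s a)%:M.
  by rewrite -[LHS]mulmx1 -rhoE1 -rhoM char_sys_mulr linearZ /= rhoE1 scalemx1.
have n0 : n = 0.
  have [a|/matrixP/(_ 0 0)/eqP|] := irr (delta_mx 0 0).
  - by rewrite rho_scalar mul_mx_scalar scalemx_sub.
  - by rewrite !mxE eqxx oner_eq0.
  - by rewrite /row_full mxrank_delta => /eqP[].
exists s; apply/lfunP=> a; rewrite mu_rho rho_scalar n0.
by subst n; rewrite mxtrace_scalar.
Qed.

Lemma char_sys_integral s j : algebraic_integer (chi s (basisC K B j)).
Proof.
apply: (@integral_eigenvalue _ _ intr _ (rmulmat j)) => [i k|].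
  by rewrite mxE; apply: integral_nat.
apply/eigenvalueP; exists (E s); last exact: char_sys_neq0.
by rewrite mul_rmulmat fusionC_mulC char_sys_mulr.
Qed.

(** Compares coefficients of x_j in the expansion of x_i over the E_s. *)
Lemma char_sys_sum i j : \sum_s chi s (basisC K B i) * E s 0 j = (j == i)%:R.
Proof.
have [_ _ dec _] := chiE.
transitivity (basisC K B i 0 j); last by rewrite mxE eqxx.
rewrite [in RHS](dec (basisC K B i)) summxE.
by apply: eq_bigr => s _; rewrite mxE.
Qed.

(** * Class sums and their structure constants *)

Local Notation D := ((FPdimR K B)%:C).

Lemma fourier_on_basisC (f : RC) i :
  fourier f (basisC K B i) = f 0 (dual B i) * D.
Proof.
rewrite sum_lfunE (bigD1 (dual B i)) //= big1 => [|j nj].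
  rewrite scale_lfunE dual_basis_basisC dualK eqxx addr0.
  by rewrite /GRing.scale /= mulr1.
rewrite scale_lfunE dual_basis_basisC -(inj_eq (inv_inj (@dualK _ _ B))) dualK.
by rewrite (negPf nj) scaler0.
Qed.

Lemma omega_class_sum i s :
  omega i (class_sum (chi s)) = E s 0 (dual B i) * D / (FPdim K B i)%:C.
Proof. by rewrite /omega /class_sum pci_char_sys fourier_on_basisC. Qed.

Lemma dualC_basisP (mu nu : dRC) :
  (forall i, mu (basisC K B i) = nu (basisC K B i)) -> mu = nu.
Proof.
move=> eq_mn; apply/lfunP=> a; rewrite (basisC_decomp a) !linear_sum.
by apply: eq_bigr => i _; rewrite !linearZ /= eq_mn.
Qed.

Lemma class_sum_span (mu : dRC) : D != 0 ->
  exists c : 'I_m.+1 -> C, mu = \sum_s c s *: class_sum (chi s).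
Proof.
have [_ _ dec _] := chiE; move=> D0.
(* [f] is the inverse Fourier transform of [mu]; its expansion over the E_s yields the
   coefficients. *)
pose f : RC := \row_j (mu (basisC K B (dual B j)) / D).
exists (fun s => chi s f); apply: dualC_basisP => i.
transitivity (f 0 (dual B i) * D); first by rewrite mxE dualK divfK.
rewrite sum_lfunE [in LHS](dec f) summxE mulr_suml; apply: eq_bigr => s _.
by rewrite scale_lfunE /class_sum pci_char_sys fourier_on_basisC mxE -mulrA.
Qed.

Lemma sum_Irr (V : zmodType) (F : dRC -> V) :
  (\sum_(mu \in @Irr K R m B) F mu = \sum_s F (chi s))%classic.
Proof.
have -> : @Irr K R m B = [set` codom chi]%classic.
  apply/seteqP; split=> mu /=.
    by case/Irr_char_sysP => s ->; apply: codom_f.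
  by case/codomP => s ->; apply: Irr_char_sys.
rewrite -fsbig_seq ?big_image //.
by apply/injectiveP/char_sys_inj.
Qed.

Lemma star_prod_class_sum r s : D != 0 ->
  star_prod (class_sum (chi r)) (class_sum (chi s)) =
  \sum_t struct_const (chi t) (chi r) (chi s) *: class_sum (chi t).
Proof.
move=> D0.
set S := star_prod _ _; have [c Sc] := class_sum_span S D0.
rewrite /struct_const -/S; set P := (X in xget _ X).
(* Once an admissible family exists, the one picked by [xget] satisfies the expansion. The witness
   is [c] carried to [Irr] along the injective [chi] and extended by 0. *)
suff /(xgetPex (fun=> 0)) [_ {1}->] : exists c, P c by rewrite sum_Irr.
exists (fun mu => \sum_t (mu == chi t)%:R * c t); split=> [mu Imu|].
  apply: big1 => t _; case: eqP => [mut|_]; last by rewrite mul0r.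
  by case: Imu; rewrite mut; apply: Irr_char_sys.
rewrite sum_Irr [LHS]Sc; apply: eq_bigr => t _; congr (_ *: _).
rewrite (bigD1 t) //= eqxx mul1r big1 ?addr0 // => u /negPf nut.
by rewrite (inj_eq char_sys_inj) eq_sym nut mul0r.
Qed.

End CharacterSystem.

Lemma omegaE i (mu : dRC) : omega i mu = mu (normalized_basis K B i).
Proof. by rewrite /omega linearZ /= mulrC. Qed.

Lemma omega_star_prod i (mu nu : dRC) : FPdim K B i != 0 ->
  omega i (star_prod mu nu) = omega i mu * omega i nu.
Proof. by move=> di0; rewrite !omegaE star_prodE. Qed.

End Characters.

(** * The two implications *)

Theorem theorem4p7 (K : realType) (R : comNzRingType) (m : nat)
    (B : fusion_ring R m) (d : K[i]) :
  let prop_a := forall nu rho psi : dualC K B,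
    Irr nu -> Irr rho -> Irr psi ->
    algebraic_integer (d * struct_const nu rho psi) in
  let prop_b := forall (i : 'I_m.+1) (rho : dualC K B),
    Irr rho -> algebraic_integer (omega i (d *: class_sum rho)) in
  let prop_c := forall i : 'I_m.+1,
    algebraic_integer (d * (FPdimR K B)%:C / (FPdim K B i)%:C) in
  (prop_a -> prop_b) /\ (prop_b -> prop_c).
Proof.
move=> prop_a prop_b prop_c; have [chi [E chiE]] := character_system_exists K B.
have omegaZ i (mu : dualC K B) : omega i (d *: mu) = d * omega i mu :> K[i].
  by rewrite !omegaE scale_lfunE.
split=> [a i _ /(Irr_char_sysP chiE)[r ->]|b i]; last first.
  have -> : d * (FPdimR K B)%:C / (FPdim K B i)%:C =
      \sum_s chi s (basisC K B (dual B i)) * omega i (d *: class_sum (chi s)).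
    have sum1 : \sum_s chi s (basisC K B (dual B i)) * E s 0 (dual B i) = 1.
      by rewrite (char_sys_sum chiE) eqxx.
    rewrite -[LHS]mulr1 -sum1 mulr_sumr.
    apply: eq_bigr => s _; rewrite omegaZ (omega_class_sum chiE).
    by ring.
  apply: big_ind => [||s _]; [exact: integral0|exact: integral_add|].
  apply: integral_mul; first exact: char_sys_integral chiE _ _.
  exact: b (Irr_char_sys chiE _).
(* If d_i = 0, then omega_i = 0 by the convention x / 0 = 0. *)
have [di0|di0] := eqVneq (FPdim K B i) 0.
  by rewrite /omega di0 invr0 mulr0; apply: integral0.
(* If FPdim(R) = 0, the Fourier transform vanishes, and so do all class sums. *)
have [D0|D0] := eqVneq ((FPdimR K B)%:C) 0.
  rewrite omegaZ (omega_class_sum chiE) D0 mulr0 mul0r mulr0.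
  by apply: integral0.
(* Column s holds the coordinates of d S^r star S^s, so applying omega_i gives a left eigenvector,
   as [eigenvalue] expects. *)
pose A := \matrix_(t, s) (d * struct_const (chi t) (chi r) (chi s)).
apply: (@integral_eigenvalue _ _ intr _ A) => [t s|].
  by rewrite mxE; apply: a; apply: (Irr_char_sys chiE).
apply/eigenvalueP; exists (\row_t omega i (class_sum (chi t))).
  apply/rowP=> s; rewrite !mxE omegaZ -mulrA -omega_star_prod //.
  rewrite (star_prod_class_sum chiE) // omegaE sum_lfunE mulr_sumr.
  by apply: eq_bigr => t _; rewrite !mxE scale_lfunE -omegaE mulrC -mulrA.
(* A zero eigenvector would make (E_s)_{i*} = 0 for all s, whereas [char_sys_sum] gives a
   combination of these equal to 1. *)
apply/eqP=> v0; have /eqP := char_sys_sum chiE (dual B i) (dual B i).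
rewrite eqxx big1 ?(eq_sym 0) ?oner_eq0 // => s _.
have /rowP/(_ s)/eqP := v0; rewrite !mxE (omega_class_sum chiE).
rewrite !mulf_eq0 invr_eq0 (negPf D0) fmorph_eq0 (negPf di0) !orbF => /eqP->.
by rewrite mulr0.
Qed.
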